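(* For every $n\ge 1$ and every permutation $\sigma\in\mathfrak{S}_n$, with image $\hat\sigma:=\Psi(\sigma)$, one has $$\bigl(\mathrm{P}_9(\sigma),\mathrm{P}_{10}(\sigma),\mathrm{P}_{11}(\sigma),\mathrm{P}_{12}(\sigma)\bigr)=\bigl(\mathrm{P}_{10}(\hat\sigma),\mathrm{P}_{9}(\hat\sigma),\mathrm{P}_{12}(\hat\sigma),\mathrm{P}_{11}(\hat\sigma)\bigr).$$
   Context: $\mathfrak{S}_n$ is the set of permutations $\sigma=\sigma_1\sigma_2\cdots\sigma_n$ of $[n]=\{1,\dots,n\}$ in one-line notation. A mesh pattern is a pair $p=(\pi,R)$ with $\pi\in\mathfrak{S}_m$ and $R\subseteq\{0,\dots,m\}\times\{0,\dots,m\}$ (the set of shaded unit cells, each given by its bottom-left corner, in the grid with dots at $(i,\pi_i)$). An occurrence of $p$ in $\sigma\in\mathfrak{S}_n$ is a choice of indices $i_1<\cdots<i_m$ such that $\sigma_{i_1}\cdots\sigma_{i_m}$ is order-isomorphic to $\pi$ and, for every $(a,b)\in R$, there is no index $r$ with $i_a<r<i_{a+1}$ and $v_b<\sigma_r<v_{b+1}$; here $v_1<\cdots<v_m$ is the increasing rearrangement of $\sigma_{i_1},\dots,\sigma_{i_m}$, $i_0=v_0=0$ and $i_{m+1}=v_{m+1}=n+1$. $p(\sigma)$ denotes the number of occurrences of $p$ in $\sigma$. The mesh patterns: $\mathrm{P}_9=(123,R)$ and $\mathrm{P}_{10}=(132,R)$ with $R=\{(0,1),(0,2),(1,1),(1,2),(3,0),(3,1),(3,2),(3,3)\}$;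 $\mathrm{P}_{11}=(123,R')$ and $\mathrm{P}_{12}=(132,R')$ with $R'=\{(1,0),(0,2),(1,1),(1,2),(3,0),(3,1),(3,2),(3,3)\}$. Active zone: for $\sigma\in\mathfrak{S}_n$, if $\sigma_n=1$ put $I(\sigma)=\varnothing$. Otherwise $I(\sigma)=[a,b]$ (the interval of integers $x$ with $a\le x\le b$), where, with $j=\min\{i:\sigma_i<\sigma_n\}$, $a=\sigma_j+1$, and $b=n$ if $j=1$, while $b=\min\{\sigma_i:i<j\}-1$ if $j>1$. The map $\Psi:\mathfrak{S}_n\to\mathfrak{S}_n$: $\Psi(\sigma)=\hat\sigma$ where, for $1\le i\le n$, $\hat\sigma_i=\sigma_i$ if $\sigma_i\notin I(\sigma)$, and $\hat\sigma_i=a+b-\sigma_i$ if $\sigma_i\in I(\sigma)=[a,b]$. *)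

(* Defs.v *)
From mathcomp Require Import all_boot all_fingroup.

Set Implicit Arguments.
Unset Strict Implicit.
Unset Printing Implicit Defensive.

(* 'S_n permutes {0,...,n-1}.  The indices, values and grid coordinates of the
   mathematics are 1-based: position i : 'I_n stands for i.+1, and the letter
   there is (s i).+1. *)
Definition oneline n (s : 'S_n) : seq nat := [seq (s i).+1 | i <- enum 'I_n].

Record mesh_pattern m := MeshPattern {
  mp_perm : 'S_m;
  mp_shade : {set 'I_m.+1 * 'I_m.+1} }.

Section Occurrences.
Variables (m n : nat) (p : mesh_pattern m) (s : 'S_n) (t : m.-tuple 'I_n).

(* 0 = i_0 < i_1 < ... < i_m < i_{m+1} = n+1 *)
Definition grid_pos : seq nat := 0 :: [seq (val i).+1 | i <- t] ++ [:: n.+1].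

(* 0 = v_0 < v_1 < ... < v_m < v_{m+1} = n+1 *)
Definition grid_val : seq nat :=
  0 :: sort leq [seq (s i).+1 | i <- t] ++ [:: n.+1].

Definition in_cell (a b : nat) (r : 'I_n) : bool :=
  (nth 0 grid_pos a < r.+1 < nth 0 grid_pos a.+1) &&
  (nth 0 grid_val b < (s r).+1 < nth 0 grid_val b.+1).

Definition occurrence : bool :=
  [&& sorted ltn (map val t),
      [forall k : 'I_m, forall l : 'I_m,
        (s (tnth t k) < s (tnth t l)) == (mp_perm p k < mp_perm p l)]
    & [forall c in mp_shade p, forall r : 'I_n, ~~ in_cell c.1 c.2 r]].

End Occurrences.

Definition occ m n (p : mesh_pattern m) (s : 'S_n) : nat :=
  #|[set t : m.-tuple 'I_n | occurrence p s t]|.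

Definition perm123 : 'S_3 := 1%g.
Definition perm132 : 'S_3 := tperm (inord 1) (inord 2).

Lemma oneline_perm123 : oneline perm123 = [:: 1; 2; 3].
Proof. by rewrite /oneline !enum_ordSl enum_ord0 /= !perm1. Qed.

Lemma oneline_perm132 : oneline perm132 = [:: 1; 3; 2].
Proof.
by rewrite /oneline !enum_ordSl enum_ord0 /= !permE /= -!(inj_eq val_inj) /=
  !inordK.
Qed.

Definition cells (l : seq (nat * nat)) : {set 'I_4 * 'I_4} :=
  [set c | (val c.1, val c.2) \in l].

Definition shade_R : {set 'I_4 * 'I_4} :=
  cells [:: (0,1); (0,2); (1,1); (1,2); (3,0); (3,1); (3,2); (3,3)].
Definition shade_R' : {set 'I_4 * 'I_4} :=
  cells [:: (1,0); (0,2); (1,1); (1,2); (3,0); (3,1); (3,2); (3,3)].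

Definition P9 : mesh_pattern 3 := MeshPattern perm123 shade_R.
Definition P10 : mesh_pattern 3 := MeshPattern perm132 shade_R.
Definition P11 : mesh_pattern 3 := MeshPattern perm123 shade_R'.
Definition P12 : mesh_pattern 3 := MeshPattern perm132 shade_R'.

Section ActiveZone.
Variables (n : nat) (s : 'S_n).

Definition last_letter : nat := last 0 (oneline s).

(* 0-based position of the first letter smaller than the last one. *)
Definition first_smaller : nat :=
  find (fun x => x < last_letter) (oneline s).

(* The bounds a and b are meaningful only when last_letter != 1. *)
Definition zone_lo : nat := (nth 0 (oneline s) first_smaller).+1.

(* Letters are at most n, so the neutral n does not affect the minimum of the
   nonempty prefix. *)
Definition zone_hi : nat :=
  if first_smaller == 0 then n
  else (\big[minn/n]_(x <- take first_smaller (oneline s)) x).-1.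

Definition in_zone (x : nat) : bool :=
  (last_letter != 1) && (zone_lo <= x <= zone_hi).

Definition reflect_zone (x : nat) : nat :=
  if in_zone x then zone_lo + zone_hi - x else x.

Lemma zone_hi_le : zone_hi <= n.
Proof.
rewrite /zone_hi; case: ifP => // _; apply: leq_trans (leq_pred _) _.
by elim: take => [|x l IHl]; rewrite ?big_nil // big_cons geq_min IHl orbT.
Qed.

Lemma reflect_zoneK : involutive reflect_zone.
Proof.
move=> x; rewrite {2}/reflect_zone; case: ifPn => hx; last first.
  by rewrite /reflect_zone (negbTE hx).
case/andP: (hx) => h1 /andP[lox xhi].
have xs : x <= zone_lo + zone_hi by rewrite (leq_trans xhi) // leq_addl.
rewrite /reflect_zone /in_zone h1 leq_subRL // leq_subLR.
by rewrite [x + _]addnC leq_add2l leq_add2r xhi lox subKn.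
Qed.

Lemma reflect_zone_bounds x : 0 < x <= n -> 0 < reflect_zone x <= n.
Proof.
rewrite /reflect_zone; case: ifP => // /andP[_ /andP[lox xhi]] _.
rewrite leq_subLR (leq_add lox zone_hi_le) andbT subn_gt0.
by rewrite (leq_ltn_trans xhi) // /zone_lo addSn ltnS leq_addl.
Qed.

Lemma psi_subproof (i : 'I_n) : (reflect_zone (s i).+1).-1 < n.
Proof.
have /andP[h0 hn] : 0 < reflect_zone (s i).+1 <= n.
  by apply: reflect_zone_bounds; rewrite /= ltn_ord.
by rewrite prednK.
Qed.

Definition psi_fun (i : 'I_n) : 'I_n := Ordinal (psi_subproof i).

Lemma psi_funE i : (psi_fun i).+1 = reflect_zone (s i).+1.
Proof.
have /andP[h _] : 0 < reflect_zone (s i).+1 <= n.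
  by apply: reflect_zone_bounds; rewrite /= ltn_ord.
exact: prednK.
Qed.

Lemma psi_fun_inj : injective psi_fun.
Proof.
move=> i j eq_ij; apply/(@perm_inj _ s)/val_inj/succn_inj.
by apply: (inv_inj reflect_zoneK); rewrite -!psi_funE eq_ij.
Qed.

Definition Psi : 'S_n := perm psi_fun_inj.

Lemma PsiE i : (Psi i).+1 = reflect_zone (s i).+1.
Proof. by rewrite permE psi_funE. Qed.

End ActiveZone.

(* Main.v *)
Require Import Defs.
From mathcomp Require Import all_boot all_fingroup.
From mathcomp Require Import zify.

(** Both shadings contain the whole last column, so the third letter of an
    occurrence is the last letter l of the permutation.  Call a letter small if
    it is below l and large if it is above l.  In an occurrence (i, k, last) the
    first letter is small, and the other shaded cells say two things:
    - the letter at k is either (pattern 123) a left-to-right maximum of the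
      subsequence of small letters, other than its first element, or (pattern
      132) a left-to-right minimum of the subsequence of large letters, preceded
      by some small letter;
    - i is determined by k: among the positions of small letters before k, it
      carries the largest letter for P9 and P10, and is the rightmost for P11
      and P12.
    Hence P9 and P11 both count the former positions k, which form
    [low_records], and P10 and P12 both count the latter, which form
    [high_records] ([occ_records]).

    Let j be the position of the first small letter.  All letters before j are
    large, and both kinds of records lie strictly between the letter at j and
    the minimum of the letters before j: this is the active zone, which also
    contains l.  So low records are the small letters of the zone that exceed
    all previous small letters of the zone, and high records are the large
    letters of the zone that are below all previous large letters of the zone
    ([low_records_zone], [high_records_zone]).  Psi reverses the order inside the
    zone and fixes every other letter, including those that delimit the zone; so
    the zone of the image is the same, and the two descriptions are exchanged
    ([low_records_flips]).  If l is the smallest letter, Psi is the identity and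
    there are no records of either kind. *)

Set Implicit Arguments.
Unset Strict Implicit.
Unset Printing Implicit Defensive.

(** * Records and the counting principle *)

Section Records.
Variables (n : nat) (s : 'S_n.+1).

Definition small_before (k i : 'I_n.+1) : bool := (i < k) && (s i < s ord_max).

Definition low_records : {set 'I_n.+1} :=
  [set k | [&& s k < s ord_max, [exists i, small_before k i]
    & [forall i, small_before k i ==> (s i < s k)]]].

Definition high_records : {set 'I_n.+1} :=
  [set k | [&& s ord_max < s k, [exists i, small_before k i]
    & [forall i : 'I_n.+1, (i < k) && (s ord_max < s i) ==> (s k < s i)]]].

(** The parameter [f] ranks positions: by their letter for P9 and P10, by the
    position itself for P11 and P12. *)
Definition top_small (f : 'I_n.+1 -> nat) (k i : 'I_n.+1) : bool :=
  small_before k i && [forall r, small_before k r ==> (f r <= f i)].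

Lemma low_recordsP (k : 'I_n.+1) :
  reflect [/\ s k < s ord_max, exists i, small_before k i
             & forall i, small_before k i -> s i < s k]
    (k \in low_records).
Proof.
rewrite inE; apply: (iffP and3P) => -[lt_k sm rec_k]; split=> //.
- exact/existsP.
- by move=> i; apply/implyP/(forallP rec_k).
- exact/existsP.
by apply/forallP=> i; apply/implyP/rec_k.
Qed.

Lemma high_recordsP (k : 'I_n.+1) :
  reflect [/\ s ord_max < s k, exists i, small_before k i
             & forall i : 'I_n.+1, i < k -> s ord_max < s i -> s k < s i]
    (k \in high_records).
Proof.
rewrite inE; apply: (iffP and3P) => -[lt_k sm rec_k]; split=> //.
- exact/existsP.
- by move=> i ik ni; apply: (implyP (forallP rec_k i)); rewrite ik.
- exact/existsP.
by apply/forallP=> i; apply/implyP=> /andP[]; apply: rec_k.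
Qed.

Lemma top_smallP (f : 'I_n.+1 -> nat) (k i : 'I_n.+1) :
  reflect (small_before k i /\ forall r, small_before k r -> f r <= f i)
    (top_small f k i).
Proof.
apply: (iffP andP) => -[sm_i top_i]; split=> //.
  by move=> r; apply/implyP/(forallP top_i).
by apply/forallP=> r; apply/implyP/top_i.
Qed.

(** Reading off the middle position is a bijection from occurrences to [K]:
    the last position is forced, and the first one is the unique maximizer of
    the injective ranking [f] on a nonempty set. *)
Lemma card_occ_records (p : mesh_pattern 3) (K : {set 'I_n.+1})
    (f : 'I_n.+1 -> nat) :
  injective f ->
  {in K, forall k, exists i, small_before k i} ->
  (forall i k l, occurrence p s [tuple i; k; l]
     <-> [/\ l = ord_max, k \in K & top_small f k i]) ->
  occ p s = #|K|.
Proof.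
move=> f_inj K_small occE.
pose mid (t : 3.-tuple 'I_n.+1) := tnth t (inord 1).
have midE i k l : mid [tuple i; k; l] = k by rewrite /mid /tnth inordK.
have tripleP (t : 3.-tuple 'I_n.+1) : exists i k l, t = [tuple i; k; l].
  case: t => [[|i [|k [|l []]]] //= sz_t].
  by exists i, k, l; apply/val_inj.
rewrite /occ -(card_in_imset (f := mid)) => [|t t']; last first.
  have [i [k [l ->]]] := tripleP t; have [i' [k' [l' ->]]] := tripleP t'.
  rewrite !inE !midE => /occE[-> _ top_i] /occE[-> _ top_i'] eq_k.
  move: top_i' top_i; rewrite -eq_k => /andP[sm_i' /forallP top_i'].
  case/andP=> sm_i /forallP top_i.
  have eq_i : i = i'.
    apply: f_inj; apply/eqP; rewrite eqn_leq.
    by rewrite (implyP (top_i' i)) // (implyP (top_i i')).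
  by rewrite eq_i.
congr #|pred_of_set _|; apply/setP=> k; apply/imsetP/idP => [[t]|Kk].
  have [i [k' [l ->]]] := tripleP t.
  by rewrite inE midE => /occE[_ Kk' _] ->.
have [i0 sm_i0] := K_small k Kk.
case: (arg_maxnP f sm_i0) => i sm_i max_i.
exists [tuple i; k; ord_max]; last by rewrite midE.
rewrite inE; apply/occE; split=> //; apply/andP; split=> //.
by apply/forallP=> r; apply/implyP=> /max_i.
Qed.

End Records.

(** * Occurrences with a shaded last column *)

Section ThreeLetters.
Variables (n : nat) (s : 'S_n.+1).

Lemma shade_allP (C : seq (nat * nat)) (t : 3.-tuple 'I_n.+1) :
  all (fun c => (c.1 < 4) && (c.2 < 4)) C ->
  reflect (forall r, all (fun c => ~~ in_cell s t c.1 c.2 r) C)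
    [forall c in cells C, forall r : 'I_n.+1, ~~ in_cell s t c.1 c.2 r].
Proof.
move=> /allP lt4; apply: (iffP forall_inP) => free.
  move=> r; apply/allP=> -[a b] C_ab; have /andP[/= a4 b4] := lt4 _ C_ab.
  by apply: (forallP (free (Ordinal a4, Ordinal b4) _) r); rewrite inE.
by move=> [a b]; rewrite inE /= => C_ab; apply/forallP=> r; apply: (allP (free r) _ C_ab).
Qed.

Lemma order123P (i k l : 'I_n.+1) :
  reflect (sorted ltn [:: nat_of_ord (s i); nat_of_ord (s k); nat_of_ord (s l)])
    [forall a : 'I_3, forall b : 'I_3,
      (s (tnth [tuple i; k; l] a) < s (tnth [tuple i; k; l] b))
        == (perm123 a < perm123 b)].
Proof.
apply: (iffP forallP) => [ord|/and3P[lt_ik lt_kl _] a]; last first.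
  apply/forallP=> b; rewrite !perm1 !(tnth_nth i).
  case: a b => [[|[|[|//]]] ?] [[|[|[|//]]] ?] /=; lia.
have:= forallP (ord (inord 0)) (inord 1); have:= forallP (ord (inord 1)) (inord 2).
by rewrite !perm1 !(tnth_nth i) !inordK //= => /eqP-> /eqP->.
Qed.

Lemma perm132E (a : 'I_3) : perm132 a = nth 0 [:: 0; 2; 1] a :> nat.
Proof.
have:= oneline_perm132; rewrite /oneline !enum_ordSl enum_ord0 /= => -[p0 p1 p2].
by case: a => [[|[|[|//]]] lt3]; [apply: etrans p0|apply: etrans p1|apply: etrans p2];
   congr (nat_of_ord (perm132 _)); apply: val_inj.
Qed.

Lemma order132P (i k l : 'I_n.+1) :
  reflect (sorted ltn [:: nat_of_ord (s i); nat_of_ord (s l); nat_of_ord (s k)])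
    [forall a : 'I_3, forall b : 'I_3,
      (s (tnth [tuple i; k; l] a) < s (tnth [tuple i; k; l] b))
        == (perm132 a < perm132 b)].
Proof.
apply: (iffP forallP) => [ord|/and3P[lt_il lt_lk _] a]; last first.
  apply/forallP=> b; rewrite !perm132E !(tnth_nth i).
  case: a b => [[|[|[|//]]] ?] [[|[|[|//]]] ?] /=; lia.
have:= forallP (ord (inord 0)) (inord 2); have:= forallP (ord (inord 2)) (inord 1).
by rewrite !perm132E !(tnth_nth i) !inordK //= => /eqP-> /eqP->.
Qed.

Lemma grid_val_sorted (i k l : 'I_n.+1) (v : seq nat) :
  perm_eq v [:: nat_of_ord (s i); nat_of_ord (s k); nat_of_ord (s l)] ->
  sorted ltn v ->
  grid_val s [tuple i; k; l] = 0 :: [seq x.+1 | x <- v] ++ [:: n.+2].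
Proof.
move=> eq_v lt_v; rewrite /grid_val /=; congr (_ :: _ ++ _).
have le_v : sorted leq [seq x.+1 | x <- v].
  by rewrite sorted_map; apply: sub_sorted lt_v => x y /ltnW.
rewrite -(sorted_sort leq_trans le_v); apply/esym/perm_sortP.
- exact: leq_total.
- exact: leq_trans.
- exact: anti_leq.
exact: perm_map eq_v.
Qed.

(** Here [x < y < z] are the sorted letters of the candidate occurrence.  The
    position [ord_max] always holds some letter; if [l] were not the last
    position, that letter would fall into a shaded cell of the last column. *)
Lemma occurrence_cellsP (pi : 'S_3) (C : seq (nat * nat)) (i k l : 'I_n.+1)
    (x y z : nat) :
  all (fun c => (c.1 < 4) && (c.2 < 4)) C ->
  perm_eq [:: x; y; z] [:: nat_of_ord (s i); nat_of_ord (s k); nat_of_ord (s l)] ->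
  reflect (sorted ltn [:: x; y; z])
    [forall a : 'I_3, forall b : 'I_3,
      (s (tnth [tuple i; k; l] a) < s (tnth [tuple i; k; l] b))
        == (pi a < pi b)] ->
  occurrence (MeshPattern pi (cells (C ++ [:: (3, 0); (3, 1); (3, 2); (3, 3)])))
    s [tuple i; k; l]
  <-> [/\ l = ord_max, i < k < n, x < y < z & forall r : 'I_n.+1,
        let gp := [:: 0; i.+1; k.+1; n.+1; n.+2] in
        let gv := [:: 0; x.+1; y.+1; z.+1; n.+2] in
        all (fun c => ~~ ((nth 0 gp c.1 < r.+1 < nth 0 gp c.1.+1)
          && (nth 0 gv c.2 < (s r).+1 < nth 0 gv c.2.+1))) C].
Proof.
move=> lt4 eq_v orderP; rewrite /occurrence /= andbT.
pose C' := C ++ [:: (3, 0); (3, 1); (3, 2); (3, 3)].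
have {lt4} lt4 : all (fun c => (c.1 < 4) && (c.2 < 4)) C' by rewrite all_cat lt4.
have freeP := shade_allP [tuple i; k; l] lt4.
split=> [/and3P[lt_ikl /orderP lt_v /freeP free]|].
  have l_max : l = ord_max.
    apply/val_inj/eqP; rewrite /= eqn_leq -ltnS ltn_ord /= leqNgt; apply/negP=> lt_ln.
    have: nat_of_ord (s ord_max) \notin [:: x; y; z].
      rewrite (perm_mem eq_v) !inE !val_eqE !(inj_eq perm_inj) -!val_eqE /=; lia.
    have:= free ord_max; rewrite all_cat /in_cell (grid_val_sorted eq_v lt_v) /= !inE.
    have:= ltn_ord (s ord_max); lia.
  subst l; split=> [|||r] //; first by move: lt_v; rewrite /= andbT.
  by have:= free r; rewrite all_cat /in_cell (grid_val_sorted eq_v lt_v) => /andP[].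
case=> eq_l lt_ik /andP[lt_xy lt_yz] free.
have lt_v : sorted ltn [:: x; y; z] by rewrite /= lt_xy lt_yz.
apply/and3P; split; [by rewrite eq_l|exact/orderP|apply/freeP=> r].
rewrite all_cat /in_cell (grid_val_sorted eq_v lt_v) eq_l free /=.
have:= ltn_ord r; lia.
Qed.

(** Injectivity of [s] as a case distinction on the underlying numbers, the form
    that linear arithmetic can use. *)
Lemma distinct_letters (i r : 'I_n.+1) :
  (nat_of_ord r = i /\ nat_of_ord (s r) = s i)
  \/ (nat_of_ord r <> i /\ nat_of_ord (s r) <> s i).
Proof.
have [-> | ne_ri] := eqVneq r i; first by left.
by right; split=> [/val_inj|/val_inj/perm_inj] /eqP; rewrite (negbTE ne_ri).
Qed.

Lemma before_last (k : 'I_n.+1) : s k < s ord_max \/ s ord_max < s k -> k < n.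
Proof.
move=> ne_k; have := ltn_ord k; rewrite ltnS leq_eqVlt => /orP[/eqP eq_k|//].
have eq_km : k = ord_max by apply: val_inj.
by rewrite eq_km in ne_k; lia.
Qed.

Lemma perm_swap132 (i k l : 'I_n.+1) :
  perm_eq [:: nat_of_ord (s i); nat_of_ord (s l); nat_of_ord (s k)]
    [:: nat_of_ord (s i); nat_of_ord (s k); nat_of_ord (s l)].
Proof. by rewrite perm_cons (perm_catC [:: _] [:: _]). Qed.

(** No letter before [k] lies strictly between the letter at [i] and the last
    letter: this makes [i] carry the largest small letter before [k], and the
    letter at [k], larger still, a new maximum. *)
Lemma occurrence_P9 (i k l : 'I_n.+1) :
  occurrence P9 s [tuple i; k; l]
  <-> [/\ l = ord_max, k \in low_records s & top_small s (fun r => s r) k i].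
Proof.
rewrite (occurrence_cellsP (C := [:: (0, 1); (0, 2); (1, 1); (1, 2)]) isT
  (perm_refl _) (order123P i k l)) /=.
split=> [[-> lt_ik lt_v free]|].
  have max_i r : small_before s k r -> s r <= s i.
    case/andP=> lt_rk lt_r; have:= free r.
    have:= distinct_letters i r; have:= distinct_letters k r; lia.
  split=> //; last by apply/top_smallP; split=> //; apply/andP; lia.
  apply/low_recordsP; split=> [||r /max_i]; [lia| |lia].
  by exists i; apply/andP; lia.
case=> -> /low_recordsP[lt_k _ rec_k] /top_smallP[sm_i max_i].
have lt_ik := rec_k i sm_i; have lt_kn := before_last (or_introl lt_k).
case/andP: sm_i => lt_i lt_si; split=> // [||r]; [lia|lia|].
have:= rec_k r; have:= max_i r; rewrite /small_before; lia.
Qed.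

(** Column 1 has no small letter, so [i] is the last small position before [k];
    together with the cell (0, 2), this makes the letter at [k] larger than all
    small letters before it. *)
Lemma occurrence_P11 (i k l : 'I_n.+1) :
  occurrence P11 s [tuple i; k; l]
  <-> [/\ l = ord_max, k \in low_records s & top_small s (fun r => r) k i].
Proof.
rewrite (occurrence_cellsP (C := [:: (1, 0); (0, 2); (1, 1); (1, 2)]) isT
  (perm_refl _) (order123P i k l)) /=.
split=> [[-> lt_ik lt_v free]|].
  have max_i r : small_before s k r -> r <= i.
    case/andP=> lt_rk lt_r; have:= free r.
    have:= distinct_letters i r; have:= distinct_letters k r; lia.
  split=> //; last by apply/top_smallP; split=> //; apply/andP; lia.
  apply/low_recordsP; split=> [||r sm_r]; [lia| |].
    by exists i; apply/andP; lia.
  have:= free r; have:= max_i r sm_r; case/andP: sm_r.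
  have:= distinct_letters i r; have:= distinct_letters k r; lia.
case=> -> /low_recordsP[lt_k _ rec_k] /top_smallP[sm_i max_i].
have lt_ik := rec_k i sm_i; have lt_kn := before_last (or_introl lt_k).
case/andP: sm_i => lt_i lt_si; split=> // [||r]; [lia|lia|].
have:= rec_k r; have:= max_i r; rewrite /small_before; lia.
Qed.

(** No letter before [k] lies strictly between the letters at [i] and [k]:
    small letters are at most the one at [i], and large ones exceed the one
    at [k]. *)
Lemma occurrence_P10 (i k l : 'I_n.+1) :
  occurrence P10 s [tuple i; k; l]
  <-> [/\ l = ord_max, k \in high_records s & top_small s (fun r => s r) k i].
Proof.
rewrite (occurrence_cellsP (C := [:: (0, 1); (0, 2); (1, 1); (1, 2)]) isT
  (perm_swap132 i k l) (order132P i k l)) /=.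
split=> [[-> lt_ik lt_v free]|].
  have max_i r : small_before s k r -> s r <= s i.
    case/andP=> lt_rk lt_r; have:= free r.
    have:= distinct_letters i r; have:= distinct_letters k r; lia.
  split=> //; last by apply/top_smallP; split=> //; apply/andP; lia.
  apply/high_recordsP; split=> [||r lt_rk lt_r]; [lia| |].
    by exists i; apply/andP; lia.
  have:= free r; have:= distinct_letters i r; have:= distinct_letters k r; lia.
case=> -> /high_recordsP[lt_k _ rec_k] /top_smallP[sm_i max_i].
have lt_kn := before_last (or_intror lt_k).
case/andP: sm_i => lt_i lt_si; split=> // [||r]; [lia|lia|].
have:= rec_k r; have:= max_i r; have:= distinct_letters ord_max r.
rewrite /small_before /=; lia.
Qed.

(** As for P11, [i] is the last small position before [k]; the shaded cells
    also forbid large letters below the one at [k]. *)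
Lemma occurrence_P12 (i k l : 'I_n.+1) :
  occurrence P12 s [tuple i; k; l]
  <-> [/\ l = ord_max, k \in high_records s & top_small s (fun r => r) k i].
Proof.
rewrite (occurrence_cellsP (C := [:: (1, 0); (0, 2); (1, 1); (1, 2)]) isT
  (perm_swap132 i k l) (order132P i k l)) /=.
split=> [[-> lt_ik lt_v free]|].
  have max_i r : small_before s k r -> r <= i.
    case/andP=> lt_rk lt_r; have:= free r.
    have:= distinct_letters i r; have:= distinct_letters k r; lia.
  split=> //; last by apply/top_smallP; split=> //; apply/andP; lia.
  apply/high_recordsP; split=> [||r lt_rk lt_r]; [lia| |].
    by exists i; apply/andP; lia.
  have:= free r; have:= distinct_letters i r; have:= distinct_letters k r; lia.
case=> -> /high_recordsP[lt_k _ rec_k] /top_smallP[sm_i max_i].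
have lt_kn := before_last (or_intror lt_k).
case/andP: sm_i => lt_i lt_si; split=> // [||r]; [lia|lia|].
have:= rec_k r; have:= max_i r; have:= distinct_letters ord_max r.
rewrite /small_before /=; lia.
Qed.

End ThreeLetters.

Lemma low_records_small n (s : 'S_n.+1) :
  {in low_records s, forall k, exists i, small_before s k i}.
Proof. by move=> k /low_recordsP[]. Qed.

Lemma high_records_small n (s : 'S_n.+1) :
  {in high_records s, forall k, exists i, small_before s k i}.
Proof. by move=> k /high_recordsP[]. Qed.

Lemma occ_records n (s : 'S_n.+1) :
  [/\ occ P9 s = #|low_records s|, occ P10 s = #|high_records s|,
      occ P11 s = #|low_records s| & occ P12 s = #|high_records s|].
Proof.
have val_s_inj : injective (fun r => nat_of_ord (s r)).
  by move=> i j /val_inj/perm_inj.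
split; [apply: (card_occ_records val_s_inj)|apply: (card_occ_records val_s_inj)
  |apply: (card_occ_records val_inj)|apply: (card_occ_records val_inj)];
  try exact: low_records_small; try exact: high_records_small.
- exact: occurrence_P9.
- exact: occurrence_P10.
- exact: occurrence_P11.
- exact: occurrence_P12.
Qed.

(** * Flipping the active zone *)

Section Zone.
Variable n : nat.
Implicit Types s t : 'S_n.+1.

(** The zone is the set of letters x with s j < x < b.  The last two
    conditions say that b is the minimum of the letters before j when there are any, and that
    no letter reaches b otherwise. *)
Definition is_zone s (j : 'I_n.+1) (b : nat) : Prop :=
  [/\ s j < s ord_max < b, forall k : 'I_n.+1, k < j -> b <= s k
    & forall i : 'I_n.+1, b <= s i -> exists2 k : 'I_n.+1, k < j & s k <= s i].

(** [y] is the image of [x] under the reflection of the open interval (a, b),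
    fixing everything outside; a relation, so that its two branches can be
    handed to linear arithmetic. *)
Definition flips (a b x y : nat) : Prop :=
  (a < x < b /\ x + y = a + b) \/ (~~ (a < x < b) /\ y = x).

(** The letters that delimit the zone lie outside it, hence are fixed, and the
    reflection preserves the zone; so the image has the same zone. *)
Lemma zone_flips s t j b : is_zone s j b ->
  (forall i, flips (s j) b (s i) (t i)) -> is_zone t j b /\ t j = s j :> nat.
Proof.
move=> [zone_l pre_hi hi_pre] flip.
have tj : t j = s j :> nat by case: (flip j); lia.
split=> //; split.
- by rewrite tj; case: (flip ord_max); lia.
- by move=> k /pre_hi; case: (flip k); lia.
move=> i hi_i; have/hi_pre[k lt_kj le_k] : b <= s i by case: (flip i); lia.
by exists k => //; have:= pre_hi k lt_kj; case: (flip k) (flip i) => ? []; lia.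
Qed.

(** A low record exceeds the first small letter [s j], so it lies in the zone;
    a small letter outside the zone is at most [s j] and never matters. *)
Lemma low_records_zone s j b k : is_zone s j b ->
  k \in low_records s <->
  s j < s k < s ord_max /\
  forall i : 'I_n.+1, i < k -> s j < s i < s ord_max -> s i < s k.
Proof.
move=> [zone_l pre_hi _]; have lt_pre (i : 'I_n.+1) : s i < s ord_max -> j <= i.
  by move=> lt_i; rewrite leqNgt; apply/negP=> /pre_hi; lia.
split=> [/low_recordsP[lt_k [i sm_i] rec_k]|[/andP[lt_jk lt_k] rec_k]].
  split=> [|r lt_rk /andP[_ lt_r]]; last by apply: rec_k; apply/andP.
  have sm_j : small_before s k j.
    case/andP: sm_i => lt_ik lt_i; apply/andP; split; last lia.
    by have:= lt_pre i lt_i; lia.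
  by rewrite rec_k.
have := lt_pre k lt_k; have := distinct_letters s j k => dist_jk le_jk.
apply/low_recordsP; split=> // [|i /andP[lt_ik lt_i]].
  by exists j; apply/andP; lia.
by have := rec_k i lt_ik; lia.
Qed.

(** A high record comes after [j], hence after all the letters before [j], and
    must be below their minimum; so it lies in the zone, and large letters
    outside the zone never matter. *)
Lemma high_records_zone s j b k : is_zone s j b ->
  k \in high_records s <->
  s ord_max < s k < b /\
  forall i : 'I_n.+1, i < k -> s ord_max < s i < b -> s k < s i.
Proof.
move=> [zone_l pre_hi hi_pre]; have lt_pre (i : 'I_n.+1) : s i < b -> j <= i.
  by move=> lt_i; rewrite leqNgt; apply/negP=> /pre_hi; lia.
split=> [/high_recordsP[lt_k [i /andP[lt_ik lt_i]] rec_k]|[/andP[lt_k lt_kb] rec_k]].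
  split=> [|r lt_rk /andP[lt_r _]]; last exact: rec_k.
  rewrite lt_k ltnNge; apply/negP=> /hi_pre[r lt_rj le_r].
  have := rec_k r; have := pre_hi r lt_rj; have := lt_pre i; lia.
have := lt_pre k lt_kb; have := distinct_letters s j k => dist_jk le_jk.
apply/high_recordsP; split=> // [|i lt_ik lt_i].
  by exists j; apply/andP; lia.
by have := rec_k i lt_ik; lia.
Qed.

Lemma flips_sym s t j b : is_zone s j b ->
  (forall i, flips (s j) b (s i) (t i)) -> forall i, flips (t j) b (t i) (s i).
Proof.
move=> zone_s flip i; have [_ ->] := zone_flips zone_s flip.
by case: (flip i) => -[]; rewrite /flips; lia.
Qed.

(** The reflection reverses the order inside the zone, which contains the last
    letter: small letters of the zone become large and maxima become minima. *)
Lemma low_records_flips s t j b : is_zone s j b ->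
  (forall i, flips (s j) b (s i) (t i)) -> low_records t = high_records s.
Proof.
move=> zone_s flip; have [zone_t tj] := zone_flips zone_s flip.
have [zone_l _ _] := zone_s; have flip_l := flip ord_max.
apply/setP=> k; have flip_k := flip k; apply/idP/idP.
  move=> /(low_records_zone k zone_t)[]; rewrite tj => zone_k rec_k.
  apply/(high_records_zone k zone_s); split=> [|i lt_ik zone_i].
    by move: flip_k flip_l; rewrite /flips; lia.
  move: (flip i) (rec_k i lt_ik) flip_k flip_l; rewrite /flips; lia.
move=> /(high_records_zone k zone_s)[zone_k rec_k].
apply/(low_records_zone k zone_t); rewrite tj; split=> [|i lt_ik zone_i].
  by move: flip_k flip_l; rewrite /flips; lia.
move: (flip i) (rec_k i lt_ik) flip_k flip_l; rewrite /flips; lia.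
Qed.

Lemma nth_oneline s (i : 'I_n.+1) : nth 0 (oneline s) i = (s i).+1.
Proof. by rewrite (nth_map i) ?size_enum_ord // nth_ord_enum. Qed.

Lemma size_oneline s : size (oneline s) = n.+1.
Proof. by rewrite size_map size_enum_ord. Qed.

Lemma last_letterE s : last_letter s = (s ord_max).+1.
Proof. by rewrite /last_letter -nth_last size_oneline (nth_oneline s ord_max). Qed.

(** The neutral [m] bounds all entries, so it does not lower their minimum. *)
Lemma bigmin_attained (m : nat) (v : seq nat) :
  v != [::] -> all (fun x => x <= m) v ->
  \big[minn/m]_(x <- v) x \in v /\ all (fun x => \big[minn/m]_(y <- v) y <= x) v.
Proof.
elim: v => // x v IHv _ /= /andP[le_xm le_vm]; rewrite big_cons.
have [-> | v0] := eqVneq v [::].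
  by rewrite big_nil /= (minn_idPl le_xm) inE eqxx leqnn.
have [min_in min_le] := IHv v0 le_vm.
rewrite geq_minl /=; split.
  by rewrite /minn; case: ifP; rewrite inE ?eqxx // min_in orbT.
by apply: sub_all min_le => y; apply: leq_trans; rewrite geq_minr.
Qed.

(** The bounds computed from the one-line notation delimit a zone.  Letters
    there are one more than the values of [s], so the inclusive bounds
    (s j).+2 and b on letters are the strict bounds s j and b on values. *)
Lemma active_zone s : s ord_max != ord0 ->
  exists j b, [/\ is_zone s j b, zone_lo s = (s j).+2 & zone_hi s = b].
Proof.
move=> l_neq0; pose small := fun x => x < last_letter s.
have has_small : has small (oneline s).
  apply/(has_nthP 0); exists (s^-1%g ord0); first by rewrite size_oneline.
  by rewrite nth_oneline permKV /small last_letterE ltnS lt0n.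
have lt_j : first_smaller s < n.+1.
  by rewrite /first_smaller -[X in _ < X](size_oneline s) -has_find.
pose j := Ordinal lt_j; exists j, (zone_hi s).
have nth_j : nth 0 (oneline s) (first_smaller s) = (s j).+1.
  exact: (nth_oneline s j).
have lt_sj : s j < s ord_max.
  by have:= nth_find 0 has_small; rewrite -/(first_smaller s) nth_j /small last_letterE.
have pre_large (k : 'I_n.+1) : k < j -> s ord_max < s k.
  move=> lt_kj; have := before_find 0 (lt_kj : k < find small (oneline s)).
  rewrite nth_oneline /small last_letterE ltnS => /negbT; rewrite -leqNgt => le_k.
  have lt_kn : k < n by apply: leq_trans lt_kj _; rewrite -ltnS.
  by case: (distinct_letters s ord_max k) => -[] /=; lia.
split; [|by rewrite /zone_lo nth_j|by []].
rewrite /zone_hi; case: ifPn => [/eqP j0|j_gt0].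
  split=> [|k|i]; last by rewrite leqNgt ltn_ord.
    by rewrite lt_sj ltn_ord.
  by rewrite /= j0.
(* For j > 0, b is attained as a letter before j, and bounds the others below. *)
pose pre := take (first_smaller s) (oneline s).
have size_pre : size pre = j by rewrite size_takel // size_oneline ltnW.
have nth_pre (k : 'I_n.+1) : k < j -> nth 0 pre k = (s k).+1.
  by move=> lt_kj; rewrite nth_take // nth_oneline.
have pre_le : all (fun x => x <= n.+1) pre.
  by apply/allP=> x /mem_take /mapP[i _ ->]; rewrite ltn_ord.
have pre_neq0 : pre != [::] by rewrite -size_eq0 size_pre.
have [/(nthP 0)[m]] := bigmin_attained pre_neq0 pre_le.
rewrite size_pre => lt_mj min_m /allP min_le.
have lt_mn : m < n.+1 by apply: ltn_trans lt_mj lt_j.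
have {min_m} min_m : \big[minn/n.+1]_(x <- pre) x = (s (Ordinal lt_mn)).+1.
  by rewrite -min_m (nth_pre (Ordinal lt_mn)).
rewrite -/pre min_m /=; split=> [|k lt_kj|i le_i].
- by rewrite lt_sj pre_large.
- by have:= min_le (s k).+1; rewrite min_m; apply; rewrite -nth_pre // mem_nth ?size_pre.
by exists (Ordinal lt_mn).
Qed.

End Zone.

(** * The map Psi exchanges the two kinds of records *)

Lemma Psi_id n (s : 'S_n.+1) : s ord_max = ord0 -> Psi s = s.
Proof.
move=> l0; apply/permP=> i; apply/val_inj/succn_inj.
by rewrite PsiE /reflect_zone /in_zone last_letterE l0.
Qed.

Lemma records_Psi n (s : 'S_n.+1) :
  low_records (Psi s) = high_records s /\ high_records (Psi s) = low_records s.
Proof.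
have [l0 | l_neq0] := eqVneq (s ord_max) ord0.
  have no_small k i : small_before s k i = false by rewrite /small_before l0 andbF.
  have no_low : low_records s = set0.
    apply/setP=> k; rewrite in_set0; apply/negP=> /low_recordsP[_ [i]].
    by rewrite no_small.
  have no_high : high_records s = set0.
    apply/setP=> k; rewrite in_set0; apply/negP=> /high_recordsP[_ [i]].
    by rewrite no_small.
  by rewrite Psi_id // no_low no_high.
have [j [b [zone_s loE hiE]]] := active_zone l_neq0.
have flip i : flips (s j) b (s i) (Psi s i).
  have := PsiE s i; rewrite /reflect_zone /in_zone loE hiE last_letterE /flips.
  have : nat_of_ord (s ord_max) <> 0 by apply/eqP.
  case: ifP; lia.
split; first exact: low_records_flips zone_s flip.
(* The flip is an involution, so the image can play the part of [s]. *)
apply/esym; have [zone_t _] := zone_flips zone_s flip.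
exact: low_records_flips zone_t (flips_sym zone_s flip).
Qed.

Theorem theorem2p9 (n : nat) (hn : 1 <= n) (s : 'S_n) :
  (occ P9 s, occ P10 s, occ P11 s, occ P12 s) =
  (occ P10 (Psi s), occ P9 (Psi s), occ P12 (Psi s), occ P11 (Psi s)).
Proof.
case: n hn s => // n _ s.
have [-> -> -> ->] := occ_records s; have [-> -> -> ->] := occ_records (Psi s).
by have [-> ->] := records_Psi s.
Qed.
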